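(* Let the sequence of random graphs $G_1,G_2,\dots$ be generated by the clustering attachment model $CA^{(\alpha,\epsilon)}$ (without node and edge deletion) with initial graph $G_0$ and parameters $\alpha>0$, $\epsilon\ge 0$ and $m_0=2$. Let $\mathcal{F}_t=\sigma\{G_0,G_1,\dots,G_t\}$, $t=0,1,2,\dots$, and let $\Delta_t=\frac13\sum_{i\in V_t}\Delta_{i,t}$ be the total count of triangles in $G_t$, where $\Delta_{i,t}$ is the number of triangles of $G_t$ containing node $i$. Then the sequence $(\Delta_0,\mathcal{F}_0),(\Delta_1,\mathcal{F}_1),\dots$ is a submartingale.
   Context: Notation: for a finite set $A$, $\|A\|$ is its cardinality. All graphs are finite, undirected and simple; $G_0=(V_0,E_0)$ is a given (non-random) graph with $V_0=\{1,\dots,\|V_0\|\}$. Clustering coefficients: for a node $i\in V_t$ of $G_t=(V_t,E_t)$ let $k_{i,t}$ be its degree and $\Delta_{i,t}$ the number of triangles of $G_t$ containing $i$ (equivalently, the number of edges between neighbours of $i$). Set $c_{i,t}=0$ if $k_{i,t}\in\{0,1\}$ and $c_{i,t}=2\Delta_{i,t}/(k_{i,t}(k_{i,t}-1))$ if $k_{i,t}\ge 2$. Model $CA^{(\alpha,\epsilon)}$ with $\alpha>0$, $\epsilon\ge0$, $m_0=2$, without node and edge deletion: for $t\ge 0$, $G_{t+1}$ is obtained from $G_t$ by (i) appending a new node $\|V_0\|+t+1$; (ii) choosing a set $W_t\subset V_t$ of $m_0=2$ distinct nodes by weighted sampling without replacement with weights $$P_{CA}(i,t)=\frac{c_{i,t}^{\alpha}+\epsilon}{\sum_{j\in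 V_t}c_{j,t}^{\alpha}+\|V_t\|\epsilon},\qquad i\in V_t,$$ and adding the two edges joining the new node to the two nodes of $W_t$. No other changes are made. Thus $V_t=\{1,\dots,\|V_0\|+t\}$. Weighted sampling without replacement of two nodes means: given the graphs up to step $t$, the first node is $i$ with probability $P_{CA}(i,t)$; given that the first node is $i$, the second node is $j\ne i$ with probability $P_{CA}(j,t)/(1-P_{CA}(i,t))$. $W_t$ is the resulting unordered pair. Standing assumption on $G_0$: if $\epsilon>0$, then $\|V_0\|\ge m_0=2$; if $\epsilon=0$, then $\|\tilde V_0\|\ge m_0=2$, where $\tilde V_0=\{i\in V_0: c_{i,0}>0\}$. *)

(* Defs.v *)
From HB Require Import structures.
From mathcomp Require Export all_boot all_order all_algebra.
From mathcomp Require Export all_classical all_reals all_analysis.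
Import Order.TTheory GRing.Theory Num.Theory.
Import numFieldNormedType.Exports.

Set Implicit Arguments.
Unset Strict Implicit.
Unset Printing Implicit Defensive.

Local Open Scope ring_scope.

(* A finite simple undirected graph on the node set {0, ..., n-1} is the set of
   its edges, an edge being an unordered pair of distinct nodes. *)
Record sgraph (n : nat) := SGraph {
  edges : {set {set 'I_n}};
  edges_card2 : [forall e in edges, #|e| == 2%N] }.

HB.instance Definition _ (n : nat) := [isSub for @edges n].
HB.instance Definition _ (n : nat) := [Finite of sgraph n by <:].

Section Graph.
Local Open Scope set_scope.
Variable n : nat.
Implicit Types (g : sgraph n) (i j : 'I_n) (W : {set 'I_n}).

Definition adj g : rel 'I_n := fun i j => [set i; j]%SET \in edges g.

Definition degree g i : nat := #|[set j : 'I_n | adj g i j]%SET|.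

Definition triangles g : {set {set 'I_n}} :=
  [set D : {set 'I_n} | (#|D| == 3%N) &&
     [forall i in D, forall j in D, (i != j) ==> adj g i j]]%SET.

Definition node_triangles g i : nat :=
  #|[set D in triangles g | i \in D]%SET|.

Definition old_node i : 'I_n.+1 := widen_ord (leqnSn n) i.

Definition attach_edges g W : {set {set 'I_n.+1}} :=
  ([set old_node @: (e : {set 'I_n}) | e in edges g]
   :|: [set [set ord_max; old_node i] | i in W])%SET.

Lemma attach_card2 g W : [forall e in attach_edges g W, #|e| == 2%N].
Proof.
have inj : injective old_node by move=> i j [] /val_inj.
apply/forallP => e; apply/implyP; rewrite inE => /orP[] /imsetP[x xP ->].
- by rewrite card_imset //; exact: (implyP (forallP (edges_card2 g) x)).
- by rewrite cards2 -val_eqE /= neq_ltn ltn_ord orbT.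
Qed.

(* The new node is [ord_max]; it is joined to (the images of) the nodes of W. *)
Definition attach g W : sgraph n.+1 := SGraph (attach_card2 g W).

End Graph.

Section Attachment.
Variables (R : realType) (n : nat).
Implicit Types (g : sgraph n) (i j : 'I_n) (S : {set 'I_n}).

Definition triangle_count g : R :=
  3^-1 * \sum_(i < n) (node_triangles g i)%:R.

Definition clustering g i : R :=
  let k := degree g i in
  if (k <= 1)%N then 0
  else 2 * (node_triangles g i)%:R / (k%:R * (k%:R - 1)).

Definition P_CA (alpha eps : R) g i : R :=
  (clustering g i `^ alpha + eps) /
  (\sum_(j < n) clustering g j `^ alpha + n%:R * eps).

(* Distribution of the unordered pair obtained by weighted sampling of two
   nodes without replacement: the sum, over the ordered draws (i, j) whose
   underlying set is S, of the probability of drawing i and then j. *)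
Definition sampling2 (p : 'I_n -> R) S : R :=
  \sum_(i < n) \sum_(j < n | (j != i) && (S == [set i; j]%SET))
    p i * (p j / (1 - p i)).

Definition admissible_init (eps : R) g : Prop :=
  (0 < eps -> (2 <= n)%N) /\
  (eps = 0 -> (2 <= #|[set i : 'I_n | (0 < clustering g i)%R]%SET|)%N).

End Attachment.
Arguments triangle_count R {n} g.

Section Martingale.
Local Open Scope classical_set_scope.
Context {d : measure_display} {T : measurableType d} {R : realType}.
Variable P : probability T R.
Implicit Types (F : set (set T)) (X Y : T -> R).

Definition measurable_wrt F Y : Prop :=
  forall B : set R, measurable B -> F (Y @^-1` B).

(* Y is a version of the conditional expectation of X given F. *)
Definition is_cond_exp F X Y : Prop :=
  [/\ measurable_wrt F Y,
      P.-integrable setT (EFin \o Y) &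
      forall A, F A ->
        (\int[P]_(w in A) (Y w)%:E = \int[P]_(w in A) (X w)%:E)%E].

Definition is_filtration (Fs : nat -> set (set T)) : Prop :=
  (forall t, sigma_algebra setT (Fs t) /\ Fs t `<=` measurable) /\
  (forall s t, (s <= t)%N -> Fs s `<=` Fs t).

Definition submartingale (Xs : nat -> T -> R) (Fs : nat -> set (set T)) : Prop :=
  [/\ is_filtration Fs,
      forall t, measurable_wrt (Fs t) (Xs t),
      forall t, P.-integrable setT (EFin \o Xs t) &
      forall t, exists Y, is_cond_exp (Fs t) (Xs t.+1) Y /\
                {ae P, forall w, Xs t w <= Y w}].

End Martingale.

Section Process.
Local Open Scope classical_set_scope.
Context {d : measure_display} {T : measurableType d} {R : realType}.
Variables (P : probability T R) (n0 : nat).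

(* sigma(G 0, ..., G t); the graphs carry the discrete sigma-algebra. *)
Definition history (G : forall t, T -> sgraph (t + n0)) (t : nat) :
    set (set T) :=
  <<s [set A | exists s (B : set (sgraph (s + n0))),
         (s <= t)%N /\ A = G s @^-1` B] >>.

(* [W t] is the random pair of nodes to which the node born at step [t.+1] is
   attached. Its conditional law given the graphs up to step t is that of
   weighted sampling without replacement with the weights [P_CA] of [G t]. *)
Definition clustering_attachment (alpha eps : R) (G0 : sgraph n0)
    (G : forall t, T -> sgraph (t + n0))
    (W : forall t, T -> {set 'I_(t + n0)}) : Prop :=
  [/\ forall w, G 0%N w = G0,
      forall t S, measurable (W t @^-1` [set S]),
      forall t w, #|W t w| = 2%N,
      forall t w, G t.+1 w = attach (G t w) (W t w) &
      forall t S, is_cond_exp P (history G t)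
        (\1_(W t @^-1` [set S]))
        (fun w => sampling2 (P_CA alpha eps (G t w)) S)].

End Process.

(* Main.v *)
(* Attaching a node destroys no triangle, so the triangle count is nondecreasing
   along every path. Averaging over the sampling law of the pair, with the
   current graph fixed, gives a version of the conditional expectation of the
   next count. It dominates the current count almost surely: integrating over
   the event where it does not, which belongs to the history, shows that this
   event is null. *)
Require Import Defs.
Import Order.TTheory GRing.Theory Num.Theory.

Set Implicit Arguments.
Unset Strict Implicit.
Unset Printing Implicit Defensive.

Local Open Scope ring_scope.

(** All old edges survive and [old_node] is injective, so taking images sends distinct triangles
    through [i] to distinct triangles through its copy. *)
Lemma le_node_triangles_attach (n : nat) (g : sgraph n) (S : {set 'I_n})
    (i : 'I_n) :
  (node_triangles g i <= node_triangles (attach g S) (old_node i))%N.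
Proof.
have inj : injective (@old_node n) by move=> a b [] /val_inj.
rewrite /node_triangles -(card_imset _ (imset_inj inj)).
apply/subset_leq_card/fintype.subsetP => _ /imsetP[D + ->].
rewrite !inE => /andP[/andP[cardD /forall_inP adjD] iD].
rewrite card_imset// cardD (mem_imset _ _ inj) iD andbT /=.
apply/forall_inP => _ /imsetP[a aD ->].
apply/forall_inP => _ /imsetP[b bD ->].
rewrite (inj_eq inj); apply/implyP => ab.
rewrite /adj inE; apply/orP; left; apply/imsetP.
exists [set a; b]%SET; last by rewrite imsetU !imset_set1.
exact: implyP (forall_inP (adjD a aD) b bD) ab.
Qed.

Lemma le_triangle_count_attach (R : realType) (n : nat) (g : sgraph n)
    (S : {set 'I_n}) :
  triangle_count R g <= triangle_count R (attach g S).
Proof.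
(* The last index is the new node; its triangles only add to the sum. *)
rewrite /triangle_count ler_pM2l ?invr_gt0// big_ord_recr/=.
rewrite ler_wpDr// ler_sum// => i _.
by rewrite ler_nat le_node_triangles_attach.
Qed.

Section Measure.
Local Open Scope classical_set_scope.
Context {d : measure_display} {T : measurableType d} {R : realType}.
Variable P : probability T R.

Lemma preimage_fin_measurable (I : finType) (H : T -> I) (B : set I) :
  (forall i, measurable (H @^-1` [set i])) -> measurable (H @^-1` B).
Proof.
move=> mH.
rewrite (_ : H @^-1` B = \bigcup_(i in B) H @^-1` [set i]).
  by apply: fin_bigcup_measurable => //; exact: finite_finset.
by apply/seteqP; split=> [w Bw|w [i Bi /= ->]//]; exists (H w).
Qed.

Lemma integrable_fin_comp (I : finType) (H : T -> I) (f : I -> R) :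
  (forall i, measurable (H @^-1` [set i])) ->
  P.-integrable setT (EFin \o (f \o H)).
Proof.
move=> mH; apply: measurable_bounded_integrable => //.
- by rewrite (le_lt_trans (probability_le1 _ _))// ltry.
- move=> _ B mB; rewrite setTI comp_preimage.
  exact: preimage_fin_measurable.
(* Summing over the finite type gives a bound that dominates every value of [f]. *)
- exists (\sum_i `|f i|); split; first by rewrite num_real.
  move=> M /ltW leM w _ /=; apply: le_trans leM.
  by rewrite (bigD1 (H w))//= lerDl sumr_ge0.
Qed.

(** On each level set of [H] the coefficients are constants and leave the integral; the level sets
    are finite in number and partition [A]. *)
Lemma integral_fin_pullout (I J : finType) (H : T -> I) (c : I -> J -> R)
    (h : J -> T -> R) (A : set T) :
  measurable A -> (forall i, measurable (H @^-1` [set i])) ->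
  (forall j, P.-integrable setT (EFin \o h j)) ->
  (\int[P]_(w in A) (\sum_j c (H w) j * h j w)%:E =
   \sum_(p : I * J) (c p.1 p.2)%:E *
      \int[P]_(w in A `&` H @^-1` [set p.1]) (h p.2 w)%:E)%E.
Proof.
move=> mA mH ih.
have ihA p : P.-integrable A ((EFin \o h p.2) \_ (H @^-1` [set p.1])).
  apply/integrable_restrict => //.
  by apply: integrableS (ih _) => //; exact: measurableI.
under [RHS]eq_bigr do rewrite integral_mkcondr -integralZl//.
rewrite -integral_sum//; last by move=> p; exact: integrableZl.
apply: eq_integral => w _.
(* Pointwise, only the level set with [i = H w] contributes; the other restrictions vanish at
   [w]. *)
rewrite -(pair_bigA _ (fun i j => (c i j)%:E *
  ((EFin \o h j) \_ (H @^-1` [set i])) w)%E)/= (bigD1 (H w))//=.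
rewrite [X in (_ + X)%E]big1 ?adde0 => [|i /eqP iHw].
  rewrite -sumEFin; apply: eq_bigr => j _.
  by rewrite patchE mem_set// EFinM.
apply: big1 => j _; rewrite patchE memNset ?mule0//.
by move=> /= /esym.
Qed.

Lemma sigma_algebra_setI (F : set (set T)) (A B : set T) :
  sigma_algebra setT F -> F A -> F B -> F (A `&` B).
Proof. by move=> /sigma_algebraP[]// _ _ _; apply. Qed.

(* [H] is known to the sigma-algebra [F], so it acts as a constant parameter;
   only the conditional law [q] of [V] is averaged. *)
Lemma is_cond_exp_fin (F : set (set T)) (I J : finType) (H : T -> I)
    (V : T -> J) (q c : I -> J -> R) :
  sigma_algebra setT F -> F `<=` measurable ->
  (forall B, F (H @^-1` B)) -> (forall j, measurable (V @^-1` [set j])) ->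
  (forall j, is_cond_exp P F (\1_(V @^-1` [set j])) (fun w => q (H w) j)) ->
  is_cond_exp P F (fun w => c (H w) (V w))
    (fun w => \sum_j c (H w) j * q (H w) j).
Proof.
move=> sF Fm FH mV qV.
have mH i : measurable (H @^-1` [set i]) by apply: Fm.
split=> [B mB| |A FA].
- exact: (FH [set i | B (\sum_j c i j * q i j)]).
- exact: (integrable_fin_comp (fun i => \sum_j c i j * q i j) mH).
- have mA := Fm _ FA.
  rewrite integral_fin_pullout//; last by move=> j; case: (qV j).
  (* Expanding in the indicators of the values of [V] brings this side to the same pulled-out form
     as the other. *)
  transitivity (\int[P]_(w in A)
      (\sum_j c (H w) j * \1_(V @^-1` [set j]) w)%:E)%E; last first.
    apply: eq_integral => w _; congr EFin.
    rewrite (bigD1 (V w))//= indicE mem_set// mulr1 big1 ?addr0// => j jVw.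
    by rewrite indicE memNset ?mulr0// => /= /esym; exact/eqP.
  rewrite integral_fin_pullout//; last by move=> j; exact: integrable_indic.
  apply: eq_bigr => p _; congr (_ * _)%E.
  (* The set [A] cut by a level set of [H] is still in [F], so there [q] and the indicator of [V]
     have equal integrals. *)
  by case: (qV p.2) => _ _; apply; exact: sigma_algebra_setI.
Qed.

(** On the event [Y w < X0 w] the gap [X0 - Y] is positive, yet its integral there is that of
    [X0 - X], hence at most zero. *)
Lemma le_cond_exp (F : set (set T)) (X0 X Y : T -> R) :
  F `<=` measurable -> F [set w | Y w < X0 w] ->
  P.-integrable setT (EFin \o X0) -> P.-integrable setT (EFin \o X) ->
  (forall w, X0 w <= X w) -> is_cond_exp P F X Y ->
  {ae P, forall w, X0 w <= Y w}.
Proof.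
move=> Fm FA iX0 iX leX [_ iY YX]; set A := [set w | _] in FA.
have mA : measurable A by apply: Fm.
have iA Z : P.-integrable setT (EFin \o Z) -> P.-integrable A (EFin \o Z).
  exact: integrableS.
have iX0A := iA _ iX0; have iYA := iA _ iY; have iXA := iA _ iX.
have absE : {in A, forall w, `|(X0 w)%:E - (Y w)%:E| =
    (X0 w)%:E - (Y w)%:E}%E.
  by move=> w /set_mem Aw; rewrite gee0_abs// -EFinB lee_fin subr_ge0 ltW.
have int0 : (\int[P]_(w in A) `|(X0 w)%:E - (Y w)%:E| = 0)%E.
  apply/eqP; rewrite eq_le integral_ge0// andbT.
  rewrite (eq_integral _ _ absE) integralB_EFin// YX//.
  rewrite sube_le0.
  by apply: le_integral => // w _; rewrite lee_fin.
have /(measurable_int P) mXY := integrableB mA iX0A iYA.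
(* A zero integral of the absolute value makes the gap vanish almost everywhere on [A], where it is
   strictly positive. *)
have /(ae_eq_integral_abs P mA mXY) := int0.
apply: filterS => w /= Aw0; rewrite leNgt; apply/negP => YX0.
have /eqP := Aw0 YX0.
by rewrite -EFinB eqe subr_eq0 gt_eqF.
Qed.

End Measure.

Section History.
Local Open Scope classical_set_scope.
Context {d : measure_display} {T : measurableType d} {n0 : nat}.
Variable G : forall t, T -> sgraph (t + n0).

Lemma history_preimage (t : nat) (B : set (sgraph (t + n0))) :
  history G t (G t @^-1` B).
Proof. by apply: sub_sigma_algebra; exists t, B. Qed.

Lemma sigma_algebra_history (t : nat) : sigma_algebra setT (history G t).
Proof. exact: smallest_sigma_algebra. Qed.

Lemma history_measurable (t : nat) :
  (forall s i, measurable (G s @^-1` [set i])) ->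
  history G t `<=` measurable.
Proof.
move=> mG; apply: smallest_sub; first exact: sigma_algebra_measurable.
by move=> _ [s [B [_ ->]]]; exact: (preimage_fin_measurable B (mG s)).
Qed.

Lemma is_filtration_history :
  (forall s i, measurable (G s @^-1` [set i])) -> is_filtration (history G).
Proof.
move=> mG; split=> [t|s t st].
  by split; [exact: sigma_algebra_history|exact: history_measurable].
apply: sub_sigma_algebra2 => A [u [B [us ->]]].
by exists u, B; split=> //; exact: leq_trans st.
Qed.

(** Measurability passes from the pairs to the graphs by induction: each graph is a function of the
    previous graph and pair, which take finitely many values. *)
Lemma graph_process_measurable (G0 : sgraph n0)
    (W : forall t, T -> {set 'I_(t + n0)}) :
  (forall w, G 0%N w = G0) ->
  (forall t S, measurable (W t @^-1` [set S])) ->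
  (forall t w, G t.+1 w = attach (G t w) (W t w)) ->
  forall t i, measurable (G t @^-1` [set i]).
Proof.
move=> G0E mW GE; elim=> [|t IHt] i.
  rewrite (_ : _ @^-1` _ = [set _ | G0 = i]); last first.
    by apply/seteqP; split=> w /=; rewrite G0E.
  have [->|G0i] := eqVneq G0 i.
    rewrite (_ : [set _ | _] = setT)//; exact/seteqP.
  by rewrite (_ : [set _ | _] = set0)//; apply/seteqP; split=> w //= /eqP;
    rewrite (negPf G0i).
rewrite (_ : _ @^-1` _ = \bigcup_(p in [set p | attach p.1 p.2 = i])
    (G t @^-1` [set p.1] `&` W t @^-1` [set p.2])).
  apply: fin_bigcup_measurable => [|p _]; last exact: measurableI.
  exact: finite_finset.
apply/seteqP; split=> [w /=|w [p <- [/= Gp Wp]]]; last by rewrite GE Gp Wp.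
by rewrite GE => <-; exists (G t w, W t w).
Qed.

End History.

Theorem corollary2 (R : realType) (d : measure_display) (T : measurableType d)
    (P : probability T R) (n0 : nat) (G0 : sgraph n0) (alpha eps : R)
    (alpha_gt0 : 0 < alpha) (eps_ge0 : 0 <= eps)
    (G0_adm : admissible_init eps G0)
    (G : forall t : nat, T -> sgraph (t + n0))
    (W : forall t : nat, T -> {set 'I_(t + n0)})
    (CA : clustering_attachment P alpha eps G0 G W) :
  submartingale P (fun t w => triangle_count R (G t w)) (history G).
Proof.
case: CA => G0E mW _ GE condW.
have mG := graph_process_measurable G0E mW GE.
have iG t : P.-integrable setT (EFin \o (fun w => triangle_count R (G t w))).
  exact: (integrable_fin_comp P (triangle_count R) (mG t)).
split=> // [|t B _|t].
- exact: is_filtration_history.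
- exact: (@history_preimage _ _ _ G t (triangle_count R @^-1` B)).
(* [c] is the count after attaching to [S], and [q] the conditional probability of drawing [S]. *)
- pose c (g : sgraph (t + n0)) S := triangle_count R (attach g S).
  pose q (g : sgraph (t + n0)) S := sampling2 (P_CA alpha eps g) S.
  exists (fun w => \sum_S c (G t w) S * q (G t w) S).
  have condY : is_cond_exp P (history G t)
      (fun w => triangle_count R (G t.+1 w))
      (fun w => \sum_S c (G t w) S * q (G t w) S).
    rewrite (_ : (fun w => _) = (fun w => c (G t w) (W t w))); last first.
      by apply/funext => w; rewrite GE.
    apply: is_cond_exp_fin => //.
    + exact: sigma_algebra_history.
    + exact: history_measurable.
    + exact: history_preimage.
    + exact: mW.
  split=> //; apply: le_cond_exp condY => //.
  + exact: history_measurable.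
  (* The exceptional event depends on the current graph alone, so it is a preimage under [G t]. *)
  + exact: (@history_preimage _ _ _ G t
      [set g | \sum_S c g S * q g S < triangle_count R g]).
  + by move=> w; rewrite GE le_triangle_count_attach.
Qed.
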